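(* The distributionally robust shortest path problem $$\min_{\mathbf{y}\in Y}\ \max_{\mathbb{Q}\in\mathcal{Q}}\ \mathbb{E}_{\mathbb{Q}}\{\mathbf{c}^\top\mathbf{y}\}$$ admits the mixed-integer programming reformulation $$\begin{aligned}\min_{\mathbf{y},\boldsymbol{\lambda},\boldsymbol{\mu},\boldsymbol{\nu}}\quad & \mathbf{b}^\top\boldsymbol{\lambda}+(\mathbf{c}^{max})^\top\boldsymbol{\nu}-(\mathbf{c}^{min})^\top\boldsymbol{\mu}\\ \text{s.t.}\quad & \boldsymbol{\lambda},\boldsymbol{\mu},\boldsymbol{\nu}\ge 0,\\ & -\mathbf{y}+\mathbf{B}^\top\boldsymbol{\lambda}+\boldsymbol{\nu}=\boldsymbol{\mu},\\ & \mathbf{y}\in Y,\end{aligned}$$ where $\boldsymbol{\lambda}\in\mathbb{R}^{D_0}$, $\boldsymbol{\mu},\boldsymbol{\nu}\in\mathbb{R}^{|A|}$, and $\mathbf{c}^{min}=(c^{min}_a)_{a\in A}$, $\mathbf{c}^{max}=(c^{max}_a)_{a\in A}$ are given by $$c^{min}_a=\min_{\mathbb{Q}_a\in\widetilde{\mathcal{Q}}_a}\mathbb{E}_{\mathbb{Q}_a}\{c_a\},\qquad c^{max}_a=\max_{\mathbb{Q}_a\in\widetilde{\mathcal{Q}}_a}\mathbb{E}_{\mathbb{Q}_a}\{c_a\};$$ i.e., the two problems have the same optimal value and the same optimal vectors $\mathbf{y}\in Y$.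
   Context: $G=(N,A)$ is a finite directed connected graph with source node $s\in N$ and destination node $t\in N$. For $i\in N$, $RS_i$ (resp. $FS_i$) is the set of arcs directed out of (resp. into) node $i$. Path-incidence vectors: $Y=\{\mathbf{y}\in\{0,1\}^{|A|}: \mathbf{G}\mathbf{y}=\mathbf{g}\}$, where $G_{ia}=1$ if $a\in RS_i$, $G_{ia}=-1$ if $a\in FS_i$, $G_{ia}=0$ otherwise, and $g_s=1$, $g_t=-1$, $g_i=0$ for all other nodes $i$. The arc cost vector $\mathbf{c}=(c_a)_{a\in A}$ is random with joint distribution $\mathbb{Q}$. $\mathcal{Q}_0(\mathbb{R}^k)$ denotes the set of all probability distributions on $\mathbb{R}^k$; $\mathbb{Q}_a$ denotes the marginal distribution of $c_a$ induced by $\mathbb{Q}$. For each arc $a\in A$ there are given a support interval $[l_a,u_a]$ with $0\le l_a\le u_a<\infty$, an index set $\mathcal{D}_a=\{1,\dots,D_a\}$, subintervals $[l^{(i)}_a,u^{(i)}_a]\subseteq[l_a,u_a]$ and numbers $0\le \underline{q}^{(i)}_a\le\overline{q}^{(i)}_a\le 1$, $i\in\mathcal{D}_a$. The last index $i=D_a$ is the support constraint: $l^{(D_a)}_a=l_a$, $u^{(D_a)}_a=u_a$, $\underline{q}^{(D_a)}_a=\overline{q}^{(D_a)}_a=1$. Moreover $\mathbf{B}\in\mathbb{R}^{D_0\times|A|}$ and $\mathbf{b}\in\mathbb{R}^{D_0}$ are given. The sets of distributions are $$\mathcal{Q}=\{\mathbb{Q}\in\mathcal{Q}_0(\mathbb{R}^{|A|}):\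 \mathbb{E}_{\mathbb{Q}}\{\mathbf{B}\mathbf{c}\}\le\mathbf{b};\ \mathbb{Q}_a\{c_a\in[l^{(i)}_a,u^{(i)}_a]\}\in[\underline{q}^{(i)}_a,\overline{q}^{(i)}_a]\ \ \forall i\in\mathcal{D}_a,\ a\in A\},$$ $$\widetilde{\mathcal{Q}}_a=\{\mathbb{Q}_a\in\mathcal{Q}_0(\mathbb{R}):\ \mathbb{Q}_a\{c_a\in[l^{(i)}_a,u^{(i)}_a]\}\in[\underline{q}^{(i)}_a,\overline{q}^{(i)}_a]\ \ \forall i\in\mathcal{D}_a\}.$$ Standing assumptions. A1: for each $a\in A$ there exists $\mathbb{Q}_a\in\widetilde{\mathcal{Q}}_a$ such that $\mathbb{Q}_a\{l^{(i)}_a\le c_a\le u^{(i)}_a\}\in(\underline{q}^{(i)}_a,\overline{q}^{(i)}_a)$ whenever $\underline{q}^{(i)}_a<\overline{q}^{(i)}_a$, $i\in\mathcal{D}_a$. A2: for each $a\in A$ and any pair $i_1,i_2\in\mathcal{D}_a$ we have $l^{(i_1)}_a\ne u^{(i_2)}_a$ and $l^{(i_2)}_a\ne u^{(i_1)}_a$. Vector inequalities are componentwise.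
   Formalization: The formal theorem assumes in addition that every c^min_a and c^max_a is attained or that the ambiguity set Q is nonempty; A1–A2 do not ensure this, and otherwise Q can be empty while the reformulation has a finite value. Max/min are read as sup/inf. *)

(* Defs.v *)
From HB Require Import structures.
From mathcomp Require Import all_boot all_order all_algebra.
From mathcomp Require Import all_classical all_reals all_analysis.

Set Implicit Arguments.
Unset Strict Implicit.
Unset Printing Implicit Defensive.

Import Order.TTheory GRing.Theory Num.Theory.
Import numFieldNormedType.Exports.

Local Open Scope classical_set_scope.
Local Open Scope ring_scope.

(* The nodes are 'I_n and the arcs are 'I_m; arc a goes from src a to tgt a.  *)
(* Vectors indexed by the arcs are 'cV[R]_m; realizations of the random cost  *)
(* vector are m.-tuple R, which carries the product (Borel) sigma-algebra.    *)

Section Graph.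
Context (R : realType) (n m : nat) (src tgt : 'I_m -> 'I_n).

(* Connectedness of the underlying undirected graph. *)
Definition graph_connected : Prop :=
  forall i j : 'I_n,
    connect (fun i j => [exists a, ((src a == i) && (tgt a == j))
                                || ((src a == j) && (tgt a == i))]) i j.

(* A loop has column sum 1 in this matrix; since, for s != t, the entries of
   the right-hand side sum to 0, a loop never belongs to a solution of G y = g. *)
Definition incidence_mx : 'M[R]_(n, m) :=
  \matrix_(i, a) (if src a == i then 1 else if tgt a == i then -1 else 0).

Definition flow_rhs (s t : 'I_n) : 'cV[R]_n :=
  \col_i (if i == s then 1 else if i == t then -1 else 0).

Definition path_vectors (s t : 'I_n) : set 'cV[R]_m :=
  [set y : 'cV[R]_m | (forall a, y a 0 = 0 \/ y a 0 = 1) /\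
           incidence_mx *m y = flow_rhs s t].

End Graph.

(* Distributional information on a single arc. There are nlast.+1 >= 1        *)
(* probability constraints; the last one, ord_max, is the support constraint. *)
Record arc_info (R : realType) := ArcInfo {
  supp_lo : R;
  supp_hi : R;
  nlast : nat;
  sub_lo : 'I_nlast.+1 -> R;
  sub_hi : 'I_nlast.+1 -> R;
  q_lo : 'I_nlast.+1 -> R;
  q_hi : 'I_nlast.+1 -> R;
  supp_lo_ge0 : 0 <= supp_lo;
  supp_lo_le_hi : supp_lo <= supp_hi;
  sub_itv : forall i,
    [/\ supp_lo <= sub_lo i, sub_lo i <= sub_hi i & sub_hi i <= supp_hi];
  q_bounds : forall i, [/\ 0 <= q_lo i, q_lo i <= q_hi i & q_hi i <= 1];
  sub_lo_last : sub_lo ord_max = supp_lo;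
  sub_hi_last : sub_hi ord_max = supp_hi;
  q_lo_last : q_lo ord_max = 1;
  q_hi_last : q_hi ord_max = 1
}.

Arguments sub_lo {R} a i : rename.
Arguments sub_hi {R} a i : rename.
Arguments q_lo {R} a i : rename.
Arguments q_hi {R} a i : rename.

Section Marginals.
Context (R : realType) (D : arc_info R).

Definition itv_prob (P : probability R R) (i : 'I_(nlast D).+1) : \bar R :=
  P `[sub_lo D i, sub_hi D i]%classic.

Definition marginal_set : set (probability R R) :=
  [set P | forall i, ((q_lo D i)%:E <= itv_prob P i <= (q_hi D i)%:E)%E].

Definition marginal_slater : Prop :=
  exists2 P, marginal_set P &
    forall i, q_lo D i < q_hi D i ->
      ((q_lo D i)%:E < itv_prob P i < (q_hi D i)%:E)%E.

Definition endpoints_distinct : Prop :=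
  forall i1 i2, i1 != i2 ->
    sub_lo D i1 <> sub_hi D i2 /\ sub_lo D i2 <> sub_hi D i1.

Definition marginal_means : set (\bar R) :=
  [set 'E_P[idfun : R -> R]%E | P in marginal_set].

(* [marginal_means] lies in [supp_lo, supp_hi], so the extended infimum and
   supremum are real numbers as soon as [marginal_set] is nonempty. They need
   not be attained: an upper bound on the probability of a closed interval is
   not preserved under weak limits. *)
Definition cmin : R := fine (ereal_inf marginal_means).
Definition cmax : R := fine (ereal_sup marginal_means).

(* The extrema of the means are a genuine minimum and maximum. *)
Definition mean_range_attained : Prop :=
  marginal_means cmin%:E /\ marginal_means cmax%:E.

End Marginals.

Definition arc_cost (R : realType) (m : nat) (a : 'I_m) (c : m.-tuple R) : R :=
  tnth c a.

HB.instance Definition _ (R : realType) (m : nat) (a : 'I_m) :=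
  isMeasurableFun.Build _ _ (m.-tuple R) R (@arc_cost R m a)
    (@measurable_tnth _ R m a).

Section Problems.
Context (R : realType) (m k : nat) (Y : set 'cV[R]_m).
Context (B : 'M[R]_(k, m)) (b : 'cV[R]_k) (D : 'I_m -> arc_info R).

(* All expectations below are of functions that are bounded Q-almost surely,
   thanks to the support constraints on the marginals. *)
Definition ambiguity_set : set (probability (m.-tuple R) R) :=
  [set Q | (forall j : 'I_k,
              'E_Q[fun c => (\sum_a B j a * arc_cost a c)%R] <= (b j 0)%:E)%E /\
           (forall a : 'I_m, marginal_set (D a) (distribution Q (arc_cost a)))].

Definition worst_case_cost (y : 'cV[R]_m) : \bar R :=
  ereal_sup [set 'E_Q[fun c => (\sum_a arc_cost a c * y a 0)%R]%E
            | Q in ambiguity_set].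

Definition dro_value : \bar R := ereal_inf [set worst_case_cost y | y in Y].

(* An empty [ambiguity_set] gives every path the cost -oo; no path is then
   considered optimal, as an optimal value has to be finite. *)
Definition dro_optimal (y : 'cV[R]_m) : Prop :=
  [/\ Y y, worst_case_cost y \is a fin_num &
      forall y', Y y' -> (worst_case_cost y <= worst_case_cost y')%E].

Definition dotv (p : nat) (u v : 'cV[R]_p) : R := \sum_i u i 0 * v i 0.

Definition mip_feasible (y : 'cV[R]_m) (lam : 'cV[R]_k) (mu nu : 'cV[R]_m) :=
  [/\ forall j, 0 <= lam j 0, forall a, 0 <= mu a 0, forall a, 0 <= nu a 0,
      - y + B^T *m lam + nu = mu & Y y].

Definition mip_cost (lam : 'cV[R]_k) (mu nu : 'cV[R]_m) : R :=
  dotv b lam + dotv (\col_a cmax (D a)) nu - dotv (\col_a cmin (D a)) mu.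

Definition mip_value : \bar R :=
  ereal_inf [set z | exists y lam mu nu,
                       mip_feasible y lam mu nu /\ z = (mip_cost lam mu nu)%:E].

Definition mip_optimal (y : 'cV[R]_m) (lam : 'cV[R]_k) (mu nu : 'cV[R]_m) :=
  mip_feasible y lam mu nu /\
  forall y' lam' mu' nu', mip_feasible y' lam' mu' nu' ->
    mip_cost lam mu nu <= mip_cost lam' mu' nu'.

End Problems.

(* Main.v *)
(* Let X be the set of mean vectors of the distributions in the ambiguity set.
   Expectation being linear, the worst-case cost of y is the supremum of
   c^T y over X. Product measures show that X consists of all c with B c <= b
   whose entries c_a are means of admissible marginals, and mixtures show that
   these means form an interval with endpoints cmin_a and cmax_a. The
   suprema over X and over the polytope {B c <= b, cmin <= c <= cmax} agree:
   under the first alternative of hwp the two sets coincide; under the second,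
   points of the polytope move into X when shifted slightly towards X.
   LP duality, from Farkas' lemma, turns the inner supremum into the minimum
   over (lambda, mu, nu). If the polytope is empty, every worst-case cost is
   -oo, and a Farkas certificate makes the mixed-integer program unbounded. *)
Require Import Defs.
From HB Require Import structures.
From mathcomp Require Import all_boot all_order all_algebra.
From mathcomp Require Import all_classical all_reals all_analysis.
From mathcomp Require Import measurable_realfun ring lra.

Set Implicit Arguments.
Unset Strict Implicit.
Unset Printing Implicit Defensive.

Import Order.TTheory GRing.Theory Num.Theory.
Import numFieldNormedType.Exports.

Local Open Scope classical_set_scope.
Local Open Scope ring_scope.

(** * Farkas' lemma: conic, infeasibility and affine forms *)

(* Bartl's induction on the number p of generators: if some x0 separates g from
   the last p of them, normalize the first functional al to 1 at x0 and
   project along x0 onto the kernel of al. *)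
Lemma farkas_cone (R : realFieldType) (p d : nat) (A : 'M[R]_(p, d))
    (g : 'rV[R]_d) :
  (forall x : 'cV_d, (forall i, (A *m x) i 0 <= 0) -> (g *m x) 0 0 <= 0) ->
  exists2 u : 'rV_p, (forall i, 0 <= u 0 i) & u *m A = g.
Proof.
elim: p A g => [|p IHp] A g hg.
  exists 0 => [i|]; first by rewrite mxE.
  (* With no generators every x is admissible, and x = [g^T] makes the sum of squares of the entries
     of [g] nonpositive. *)
  have: (g *m g^T) 0 0 <= 0 by apply: hg => -[].
  rewrite mul0mx mxE => g0; apply/rowP => j; rewrite mxE; apply/esym/eqP.
  rewrite -sqrf_eq0 eq_le sqr_ge0 andbT; apply: le_trans g0.
  rewrite (bigD1 j)//= mxE -expr2 lerDl; apply: sumr_ge0 => i _.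
  by rewrite mxE -expr2 sqr_ge0.
move: A hg; rewrite -[p.+1]/(1 + p)%N => A hg.
rewrite -[A]vsubmxK in hg *; move: (usubmx A) (dsubmx A) hg => al A' hg {A}.
have colP (x : 'cV_d) : (forall i, (A' *m x) i 0 <= 0) -> (al *m x) 0 0 <= 0 ->
    forall i, (col_mx al A' *m x) i 0 <= 0.
  move=> h1 h2 i; rewrite mul_col_mx -(fintype.splitK i).
  by case: (fintype.split i) => j /=; rewrite ?col_mxEu ?col_mxEd ?ord1.
have [hA'|/existsNP[x0 /not_implyP[hx0 /negP]]] := pselect (forall x : 'cV_d,
    (forall i, (A' *m x) i 0 <= 0) -> (g *m x) 0 0 <= 0).
  have [u u0 uA] := IHp A' g hA'.
  exists (row_mx 0 u) => [i|]; last by rewrite mul_row_col mul0mx add0r.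
  rewrite -(fintype.splitK i); case: (fintype.split i) => j /=.
    by rewrite row_mxEl mxE.
  by rewrite row_mxEr.
rewrite -ltNge => gx0.
have alx0 : 0 < (al *m x0) 0 0.
  by rewrite ltNge; apply/negP => h; have := hg x0 (colP _ hx0 h); lra.
pose r := ((al *m x0) 0 0)^-1; pose x1 := r *: x0.
have r0 : 0 < r by rewrite invr_gt0.
have alx1 : (al *m x1) 0 0 = 1.
  by rewrite -scalemxAr mxE mulVf// gt_eqF.
have gx1 : 0 < (g *m x1) 0 0 by rewrite -scalemxAr mxE mulr_gt0.
have hx1 i : (A' *m x1) i 0 <= 0.
  by rewrite -scalemxAr mxE mulr_ge0_le0// ltW.
have [|u u0 uA] := IHp (A' - A' *m x1 *m al) (g - g *m x1 *m al).
  move=> x hx.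
  pose x' := x - x1 *m al *m x.
  have E (q : nat) (M : 'M[R]_(q, d)) : (M - M *m x1 *m al) *m x = M *m x'.
    by rewrite mulmxBl mulmxBr !mulmxA.
  rewrite E; apply: hg; apply: colP; first by move=> i; rewrite -E.
  rewrite -E (mx11_scalar (al *m x1)) alx1 mul1mx subrr mul0mx mxE lexx//.
(* The multiplier of [al] undoes the projection; it is nonnegative because g x1 > 0 while u >= 0 and
   A' x1 <= 0. *)
exists (row_mx (g *m x1 - u *m A' *m x1) u) => [i|].
  rewrite -(fintype.splitK i); case: (fintype.split i) => j /=;
    last by rewrite row_mxEr.
  rewrite row_mxEl ord1 mxE [X in _ + X]mxE subr_ge0.
  apply: le_trans (ltW gx1).
  by rewrite -mulmxA mxE; apply: sumr_le0 => i' _; rewrite mulr_ge0_le0.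
rewrite mul_row_col mulmxBl -addrA.
move: uA; rewrite mulmxBr !mulmxA => uA.
by rewrite [- _ + _]addrC uA addrC subrK.
Qed.

(** Homogenization: if A x + w b <= 0 with w < 0, dividing x by -w would solve the system. So w >= 0
    on this cone, and the conic form applied to (0, -1) gives a certificate with u b = -1. *)
Lemma farkas_infeasible (R : realFieldType) (p d : nat) (A : 'M[R]_(p, d))
    (b : 'cV[R]_p) :
  ~ (exists x : 'cV_d, forall i, (A *m x) i 0 <= b i 0) ->
  exists2 u : 'rV_p, (forall i, 0 <= u 0 i) & u *m A = 0 /\ (u *m b) 0 0 < 0.
Proof.
move=> hA.
have [z hz|u u0] := @farkas_cone _ _ _ (row_mx A b) (row_mx 0 (- 1)).
  rewrite -[z]vsubmxK in hz *; move: (usubmx z) (dsubmx z) hz => x w hz {z}.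
  rewrite [w]mx11_scalar in hz *; move: (w 0 0) hz => {}w.
  rewrite !mul_row_col mul0mx add0r mulNmx mul1mx !mxE mulr1n => hz.
  rewrite leNgt; apply/negP => w0; apply: hA.
  have {}w0 : 0 < - w by [].
  exists ((- w)^-1 *: x) => i.
  have := hz i; rewrite -scalemxAr mul_mx_scalar [X in X <= _ -> _]mxE.
  rewrite [X in _ + X]mxE [X in _ -> X <= _]mxE.
  by rewrite ler_pdivrMl//; lra.
rewrite mul_mx_row => /eq_row_mx[uA ub]; exists u => //; split => //.
by rewrite ub !mxE ltrN10.
Qed.

(** Again homogenization, with an extra row forcing w <= 0. The multiplier of that row is the slack
    between u b and v. *)
Lemma farkas_affine (R : realFieldType) (p d : nat) (A : 'M[R]_(p, d))
    (b : 'cV[R]_p) (c : 'rV[R]_d) (v : R) :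
  (exists x : 'cV_d, forall i, (A *m x) i 0 <= b i 0) ->
  (forall x : 'cV_d, (forall i, (A *m x) i 0 <= b i 0) -> (c *m x) 0 0 <= v) ->
  exists2 u : 'rV_p, (forall i, 0 <= u 0 i) & u *m A = c /\ (u *m b) 0 0 <= v.
Proof.
move=> [x0 hx0] hc.
have [z hz|u u0] := @farkas_cone _ _ _ (block_mx A b 0 1) (row_mx c v%:M).
  rewrite -[z]vsubmxK in hz *; move: (usubmx z) (dsubmx z) hz => x w hz {z}.
  rewrite [w]mx11_scalar in hz *; move: (w 0 0) hz => {}w.
  rewrite mul_block_col mul_row_col mul0mx add0r mul1mx => hz.
  rewrite -scalar_mxM mxE [X in _ + X]mxE mulr1n.
  have hx i : (A *m x) i 0 + w * b i 0 <= 0.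
    by have := hz (lshift _ i); rewrite col_mxEu mul_mx_scalar !mxE.
  have : w <= 0 by have := hz (rshift _ 0); rewrite col_mxEd !mxE.
  rewrite le_eqVlt => /predU1P[w0|w0].
    (* x is a recession direction of the feasible set. *)
    rewrite leNgt; apply/negP; rewrite w0 mulr0 addr0 => cx.
    have cx0 := hc _ hx0.
    (* This step length brings the objective at x0 + r x to exactly v + 1. *)
    pose r := (v + 1 - (c *m x0) 0 0) / (c *m x) 0 0.
    have r0 : 0 <= r by apply: divr_ge0; lra.
    suff: (c *m (x0 + r *: x)) 0 0 <= v.
      rewrite mulmxDr -scalemxAr mxE [X in _ + X]mxE divfK ?gt_eqF//; lra.
    apply: hc => i; rewrite mulmxDr -scalemxAr mxE [X in _ + X]mxE.
    have := hx i; rewrite w0 mul0r addr0 => /(mulr_ge0_le0 r0).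
    by have := hx0 i; lra.
  have {}w0 : 0 < - w by lra.
  have: (c *m ((- w)^-1 *: x)) 0 0 <= v.
    apply: hc => i; rewrite -scalemxAr mxE ler_pdivrMl//.
    by have := hx i; lra.
  by rewrite -scalemxAr mxE ler_pdivrMl//; lra.
rewrite -[u]hsubmxK in u0 *; move: (lsubmx u) (rsubmx u) u0 => {}u w u0.
rewrite mul_row_block mulmx0 addr0 mulmx1 => /eq_row_mx[uA ub].
exists u => [i|]; first by have := u0 (lshift _ i); rewrite row_mxEl.
split => //; have := u0 (rshift _ 0); rewrite row_mxEr => w0.
move: ub => /matrixP/(_ 0 0); rewrite !mxE mulr1n; lra.
Qed.

(** * Mixtures and product measures *)

Lemma mixture_probability d (T : measurableType d) (R : realType)
    (P Q : probability T R) (s r : {nonneg R}) : s%:num + r%:num = 1 ->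
  exists M : probability T R,
    forall A, M A = measure_add (mscale s P) (mscale r Q) A.
Proof.
move=> srE.
pose mu : {measure set T -> \bar R} := measure_add (mscale s P) (mscale r Q).
have mu1 : mu setT = 1%E.
  transitivity (s%:num%:E * P setT + r%:num%:E * Q setT)%E.
    exact: measure_addE.
  by rewrite !probability_setT !mule1 -EFinD srE.
pose M : probability T R := HB.pack (Measure.sort mu)
  (Measure_isProbability.Build _ _ _ mu mu1).
by exists M.
Qed.

(** The product measure, built one independent coordinate at a time. Only its marginals are
    recorded, as they determine the expectation of a linear function. *)
Lemma tuple_probability (R : realType) (m : nat) (P : 'I_m -> probability R R) :
  exists Q : probability (m.-tuple R) R, forall a A, measurable A ->
    Q (arc_cost a @^-1` A) = P a A.
Proof.
elim: m P => [|m IHm] P.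
  exists (dirac [tuple]) => -[]//.
have [Q HQ] := IHm (fun i => P (lift ord0 i)).
pose f (x : R * m.-tuple R) := [the m.+1.-tuple R of x.1 :: x.2].
have mf : measurable_fun setT f.
  by apply: measurable_cons => //; exact: measurable_fst.
pose F : {mfun (R * m.-tuple R)%type >-> m.+1.-tuple R} :=
  HB.pack f (isMeasurableFun.Build _ _ _ _ f mf).
exists (distribution (P ord0 \x Q)%E F) => a A mA.
rewrite /distribution /pushforward.
have [i ->|->] := unliftP ord0 a; last first.
  have E : F @^-1` (arc_cost ord0 @^-1` A) = A `*` setT.
    by apply/seteqP; split => x /=; rewrite /arc_cost /= tnth0//= => -[].
  transitivity ((P ord0 \x Q)%E (A `*` setT)); first by rewrite -E.
  rewrite /= product_measure1E//.
  by rewrite [X in (_ * X)%E](_ : _ = 1%E) ?mule1//; exact: probability_setT.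
have E : F @^-1` (arc_cost (lift ord0 i) @^-1` A) =
    setT `*` (arc_cost i @^-1` A).
  by apply/seteqP; split => x /=; rewrite /arc_cost /= tnthS//= => -[].
transitivity ((P ord0 \x Q)%E (setT `*` (arc_cost i @^-1` A))).
  by rewrite -E.
rewrite /= product_measure1E//.
  rewrite [X in (X * _)%E](_ : _ = 1%E) ?mul1e; last exact: probability_setT.
  exact: HQ.
by rewrite -[X in measurable X]setTI; exact: measurable_tnth.
Qed.

(** * Random variables bounded almost surely *)

Section bounded_rv.
Local Open Scope ereal_scope.
Context d (T : measurableType d) (R : realType) (P : probability T R).
Variables (X : T -> R) (l u : R).
Hypothesis mX : measurable_fun setT X.
Hypothesis Plu : P (X @^-1` `[l, u]) = 1.

Let mD : measurable (X @^-1` `[l, u]).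
Proof. by rewrite -[X in measurable X]setTI; exact: mX. Qed.

Let PCD : P (~` (X @^-1` `[l, u])) = 0.
Proof. by rewrite probability_setC// Plu subee. Qed.

Lemma integrable_as_bounded : P.-integrable setT (EFin \o X).
Proof.
apply/(negligible_integrable (measurableC mD)) => //.
  by exact/measurable_EFinP.
rewrite setTD setCK; apply: measurable_bounded_integrable => //.
- by rewrite (le_lt_trans (probability_le1 P mD))// ltry.
- exact: measurable_funS mX.
(* Boundedness is phrased near +oo: every number above this one has to bound |X| on the event. *)
exists (`|l| + `|u|)%R; split; first exact: num_real.
move=> x /= xlu y /=; rewrite in_itv/= => /andP[ly yu].
apply: le_trans (ltW xlu).
have := ler_norm u; have := ler_norm (- l); rewrite normrN.
have := normr_ge0 l; have := normr_ge0 u.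
by rewrite ler_norml => *; apply/andP; split; lra.
Qed.

(** Arc costs are nonnegative on their support only; restricting to it gives access to integration
    of nonnegative functions. *)
Lemma expectation_restrict_as_bounded :
  'E_P[X] = \int[P]_(x in X @^-1` `[l, u]) (X x)%:E.
Proof.
rewrite unlock (negligible_integral (measurableC mD) _ integrable_as_bounded)//.
by rewrite setTD setCK.
Qed.

Lemma expectation_as_bounded : exists2 x : R, 'E_P[X] = x%:E & (l <= x <= u)%R.
Proof.
have iX := integrable_as_bounded.
have EX := expectation_restrict_as_bounded.
have iXD := integrableS measurableT mD (@subsetT _ _) iX.
have icst c : P.-integrable (X @^-1` `[l, u]) (cst c%:E).
  by apply: finite_measure_integrable_cst.
have lX : l%:E <= 'E_P[X].
  rewrite EX -[leLHS]mule1 -Plu -integral_cst//; apply: le_integral => //.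
  by move=> x /[!inE]/=; rewrite in_itv/= lee_fin => /andP[].
have Xu : 'E_P[X] <= u%:E.
  rewrite EX -[leRHS]mule1 -Plu -integral_cst//; apply: le_integral => //.
  by move=> x /[!inE]/=; rewrite in_itv/= lee_fin => /andP[].
case: 'E_P[X] lX Xu => //= x; rewrite !lee_fin => lx xu.
by exists x => //; rewrite lx.
Qed.

End bounded_rv.

(** * Means of the admissible marginals of one arc *)

Section means.
Local Open Scope ereal_scope.
Context (R : realType) (D : arc_info R).

Lemma marginal_set_supp (P : probability R R) : marginal_set D P ->
  P `[supp_lo D, supp_hi D]%classic = 1.
Proof.
move=> /(_ ord_max); rewrite /itv_prob q_lo_last q_hi_last.
by rewrite sub_lo_last sub_hi_last => h; apply/eqP; rewrite eq_le andbC.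
Qed.

Lemma marginal_meansP (z : \bar R) : marginal_means D z ->
  exists2 x : R, z = x%:E & (supp_lo D <= x <= supp_hi D)%R.
Proof.
move=> [P /marginal_set_supp PD <-].
exact: (@expectation_as_bounded _ _ _ P idfun _ _ (@measurable_id _ _ _) PD).
Qed.

(** The mixture of the two distributions is a witness: interval probabilities are affine in the
    measure, so their bounds survive. *)
Lemma marginal_means_convex (x y s : R) : (0 <= s <= 1)%R ->
  marginal_means D x%:E -> marginal_means D y%:E ->
  marginal_means D (s * x + (1 - s) * y)%:E.
Proof.
move=> /andP[s0 s1] [P PD Px] [Q QD Qy].
have r0 : (0 <= 1 - s)%R by rewrite subr_ge0.
pose sn : {nonneg R} := NngNum s0; pose rn : {nonneg R} := NngNum r0.
have srE : (sn%:num + rn%:num = 1)%R by rewrite /= addrC subrK.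
have [M M_] := mixture_probability P Q srE.
have ME A : M A = s%:E * P A + (1 - s)%:E * Q A by rewrite M_ measure_addE.
have MD : marginal_set D M.
  move=> i; have /andP[Pl Pu] := PD i; have /andP[Ql Qu] := QD i.
  rewrite /itv_prob ME; apply/andP; split.
    rewrite [leLHS](_ : _ = s%:E * (q_lo D i)%:E + (1 - s)%:E * (q_lo D i)%:E).
      by apply: leeD; apply: lee_wpmul2l.
    by rewrite -!EFinM -EFinD -mulrDl addrC subrK mul1r.
  rewrite [leRHS](_ : _ = s%:E * (q_hi D i)%:E + (1 - s)%:E * (q_hi D i)%:E).
    by apply: leeD; apply: lee_wpmul2l.
  by rewrite -!EFinM -EFinD -mulrDl addrC subrK mul1r.
(* On the support the identity is nonnegative, so its integral is additive in the measure. *)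
have EE (N : probability R R) : marginal_set D N ->
    'E_N[idfun : R -> R] = \int[N]_(x in `[supp_lo D, supp_hi D]%classic) x%:E.
  move=> /marginal_set_supp ND.
  exact: (@expectation_restrict_as_bounded _ _ _ N idfun _ _
    (@measurable_id _ _ _) ND).
exists M => //; rewrite EE//.
have ge0 z : `[supp_lo D, supp_hi D]%classic z -> 0 <= z%:E.
  rewrite /= in_itv/= lee_fin => /andP[+ _]; apply: le_trans.
  exact: supp_lo_ge0.
rewrite (eq_measure_integral (measure_add (mscale sn P) (mscale rn Q)));
  last by move=> A _ _; exact: M_.
have mE : measurable_fun `[supp_lo D, supp_hi D]%classic (EFin : R -> \bar R).
  by apply/measurable_EFinP; exact: measurable_id.
rewrite ge0_integral_measure_add// !ge0_integral_mscale//.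
by rewrite -!EE// Px Qy /= EFinD.
Qed.

End means.

(** * Linear programming duality over the polytope B c <= b, lo <= c <= hi *)

Section box_lp.
Context (R : realType) (m k : nat) (B : 'M[R]_(k, m)) (b : 'cV[R]_k).
Variables lo hi : 'cV[R]_m.

Lemma dotvE p (u v : 'cV[R]_p) : dotv u v = (u^T *m v) 0 0.
Proof. by rewrite mxE; apply: eq_bigr => i _; rewrite mxE. Qed.

Lemma dotvC p (u v : 'cV[R]_p) : dotv u v = dotv v u.
Proof. by apply: eq_bigr => i _; rewrite mulrC. Qed.

Lemma dotvDl p (u v w : 'cV[R]_p) : dotv (u + v) w = dotv u w + dotv v w.
Proof. by rewrite !dotvE linearD mulmxDl mxE. Qed.

Lemma dotvDr p (u v w : 'cV[R]_p) : dotv w (u + v) = dotv w u + dotv w v.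
Proof. by rewrite !(dotvC w) dotvDl. Qed.

Lemma dotvZl p c (u v : 'cV[R]_p) : dotv (c *: u) v = c * dotv u v.
Proof. by rewrite !dotvE linearZ/= -scalemxAl mxE. Qed.

Lemma dotvZr p c (u v : 'cV[R]_p) : dotv v (c *: u) = c * dotv v u.
Proof. by rewrite !(dotvC v) dotvZl. Qed.

Lemma ler_dotv p (u v w : 'cV[R]_p) : (forall i, u i 0 <= v i 0) ->
  (forall i, 0 <= w i 0) -> dotv u w <= dotv v w.
Proof. by move=> uv w0; apply: ler_sum => i _; apply: ler_wpM2r. Qed.

Definition box_feasible (c : 'cV[R]_m) :=
  (forall j, (B *m c) j 0 <= b j 0) /\ (forall a, lo a 0 <= c a 0 <= hi a 0).

(** The dual of maximizing [dotv c y] over the polytope; [mu] and [nu] are the multipliers of the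
    lower and upper bounds. As y is any vector here, y = 0 describes recession directions. *)
Definition box_dual (y : 'cV[R]_m) (lam : 'cV[R]_k) (mu nu : 'cV[R]_m) :=
  [/\ forall j, 0 <= lam j 0, forall a, 0 <= mu a 0, forall a, 0 <= nu a 0 &
      B^T *m lam + nu = y + mu].

Definition box_dual_cost (lam : 'cV[R]_k) (mu nu : 'cV[R]_m) :=
  dotv b lam + dotv hi nu - dotv lo mu.

(** Pairing the dual equation with c writes [dotv c y] as three terms, each controlled by one family
    of primal constraints. *)
Lemma box_weak_duality y lam mu nu c : box_feasible c ->
  box_dual y lam mu nu -> dotv c y <= box_dual_cost lam mu nu.
Proof.
move=> [Bc lohi] [lam0 mu0 nu0 E].
have -> : dotv c y = dotv (B *m c) lam + dotv c nu - dotv c mu.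
  have : dotv c (B^T *m lam + nu) = dotv c (y + mu) by rewrite E.
  have -> : dotv (B *m c) lam = dotv c (B^T *m lam).
    by rewrite !dotvE trmx_mul mulmxA.
  by rewrite !dotvDr => ->; rewrite addrK.
have := ler_dotv Bc lam0.
have : dotv c nu <= dotv hi nu.
  by apply: ler_dotv => // a; have /andP[] := lohi a.
have : dotv lo mu <= dotv c mu.
  by apply: ler_dotv => // a; have /andP[] := lohi a.
rewrite /box_dual_cost; lra.
Qed.

Let A : 'M[R]_(k + (m + m), m) := col_mx B (col_mx 1%:M (- 1%:M)).
Let rhs : 'cV[R]_(k + (m + m)) := col_mx b (col_mx hi (- lo)).

Let box_feasibleP c : box_feasible c <-> forall i, (A *m c) i 0 <= rhs i 0.
Proof.
rewrite /A /rhs !mul_col_mx mulNmx mul1mx; split=> [[Bc lohi] i|h].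
  rewrite -(fintype.splitK i); case: (fintype.split i) => j /=.
    by rewrite !col_mxEu.
  rewrite !col_mxEd -(fintype.splitK j); case: (fintype.split j) => a /=.
    by rewrite !col_mxEu; have /andP[] := lohi a.
  by rewrite !col_mxEd 2!mxE lerN2; have /andP[] := lohi a.
split=> [j|a]; first by have := h (lshift _ j); rewrite !col_mxEu.
apply/andP; split.
  by have := h (rshift _ (rshift _ a)); rewrite !col_mxEd;
     rewrite [leLHS]mxE [leRHS]mxE lerN2.
by have := h (rshift _ (lshift _ a)); rewrite !col_mxEd !col_mxEu.
Qed.

(** The stacked constraints have multiplier blocks in the order [lam], [nu], [mu], because the lower
    bounds come last, negated. *)
Let dual_of_row (u : 'rV[R]_(k + (m + m))) (y : 'cV[R]_m) :
  (forall i, 0 <= u 0 i) -> u *m A = y^T ->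
  exists lam mu nu, box_dual y lam mu nu /\
    box_dual_cost lam mu nu = (u *m rhs) 0 0.
Proof.
rewrite -[u]hsubmxK -[rsubmx u]hsubmxK.
move: (lsubmx u) (lsubmx (rsubmx u)) (rsubmx (rsubmx u)) => la nu mu {u} u0.
rewrite /A /rhs !mul_row_col mulmxN !mulmx1 => uA.
exists la^T, mu^T, nu^T; split.
  split=> [i|i|i|]; rewrite ?mxE.
  - by have := u0 (lshift _ i); rewrite row_mxEl.
  - by have := u0 (rshift _ (rshift _ i)); rewrite !row_mxEr.
  - by have := u0 (rshift _ (lshift _ i)); rewrite row_mxEr row_mxEl.
  by rewrite -[y]trmxK -uA !linearD linearN /= trmx_mul -!addrA addNr addr0.
rewrite /box_dual_cost 3!(dotvC _ _^T) !dotvE !trmxK mulmxN.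
rewrite [RHS]mxE -addrA; congr (_ + _).
by rewrite [RHS]mxE; congr (_ + _); rewrite [RHS]mxE.
Qed.

(** Any upper bound v stands in for the optimal value, so v can later be a supremum over the mean
    vectors alone. *)
Lemma box_strong_duality y v : (exists c, box_feasible c) ->
  (forall c, box_feasible c -> dotv c y <= v) ->
  exists lam mu nu, box_dual y lam mu nu /\ box_dual_cost lam mu nu <= v.
Proof.
move=> [c /box_feasibleP hc] hv.
have [||u u0 [uA ub]] := @farkas_affine _ _ _ A rhs y^T v; first by exists c.
  by move=> x /box_feasibleP /hv; rewrite dotvC dotvE.
have [lam [mu [nu [h1 h2]]]] := dual_of_row u0 uA.
by exists lam, mu, nu; rewrite h2.
Qed.

(** The Farkas certificate of emptiness is a recession direction of the dual along which its cost
    decreases. *)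
Lemma box_dual_ray : ~ (exists c, box_feasible c) ->
  exists lam mu nu, box_dual 0 lam mu nu /\ box_dual_cost lam mu nu < 0.
Proof.
move=> nc.
have [|u u0 [uA ub]] := @farkas_infeasible _ _ _ A rhs.
  by move=> [x /box_feasibleP hx]; apply: nc; exists x.
have [|lam [mu [nu [h1 h2]]]] := dual_of_row (y := 0) u0.
  by rewrite trmx0.
by exists lam, mu, nu; rewrite h2.
Qed.

End box_lp.

(** * The interval of attainable means *)

Section mean_range.
Context (R : realType) (D : arc_info R).
Variable x0 : R.
Hypothesis Dx0 : marginal_means D x0%:E.

(** Since [fine] sends infinities to 0, both are ruled out: -oo by the support, +oo by the mean
    [x0]. *)
Let inf_fin : ereal_inf (marginal_means D) = (cmin D)%:E.
Proof.
rewrite /cmin fineK// fin_numE; apply/andP; split.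
  have : ((supp_lo D)%:E <= ereal_inf (marginal_means D))%E.
    by apply: le_ereal_inf_tmp => _ /marginal_meansP[x -> /andP[]];
       rewrite lee_fin.
  by case: ereal_inf.
have := ereal_inf_lbound Dx0.
by case: ereal_inf.
Qed.

Let sup_fin : ereal_sup (marginal_means D) = (cmax D)%:E.
Proof.
rewrite /cmax fineK// fin_numE; apply/andP; split.
  have := ereal_sup_ubound Dx0.
  by case: ereal_sup.
have : (ereal_sup (marginal_means D) <= (supp_hi D)%:E)%E.
  by apply: ge_ereal_sup => _ /marginal_meansP[x -> /andP[]];
       rewrite lee_fin.
by case: ereal_sup.
Qed.

Lemma marginal_means_range (x : R) : marginal_means D x%:E ->
  cmin D <= x <= cmax D.
Proof.
move=> Dx; rewrite -!lee_fin -inf_fin -sup_fin.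
by rewrite ereal_inf_lbound// ereal_sup_ubound.
Qed.

Lemma marginal_means_interval (x y z : R) : marginal_means D x%:E ->
  marginal_means D y%:E -> x <= z <= y -> marginal_means D z%:E.
Proof.
move=> Dx Dy /andP[xz zy]; have [xy|xy] := ltP x y; last first.
  by rewrite (_ : z = x)//; lra.
rewrite (_ : z = (y - z) / (y - x) * x + (1 - (y - z) / (y - x)) * y).
  apply: marginal_means_convex => //; apply/andP; split.
    by apply: divr_ge0; lra.
  by rewrite ler_pdivrMr; lra.
have yx : y - x != 0 by rewrite subr_eq0 gt_eqF.
by field.
Qed.

(** This copes with unattained extrema. If x < x0, the shifted point exceeds [cmin], hence some mean
    p lies below it, and it lies between p and x0 because e <= 1. The case x > x0 is symmetric. *)
Lemma marginal_means_interior (x e : R) : 0 < e -> e <= 1 ->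
  cmin D <= x <= cmax D -> marginal_means D ((1 - e) * x + e * x0)%:E.
Proof.
move=> e0 e1 /andP[xl xu].
have [xx0|xx0|->] := ltgtP x x0; last by rewrite -mulrDl subrK mul1r.
  have h : x < (1 - e) * x + e * x0 by nra.
  have [|_ [P DP <-] PE] := @ereal_inf_lt _ (marginal_means D)
      ((1 - e) * x + e * x0)%:E.
    by rewrite inf_fin lte_fin; lra.
  have [p pE _] : exists2 p : R, _ = p%:E & _ :=
    marginal_meansP (ex_intro2 _ _ P DP erefl).
  apply: (@marginal_means_interval p x0) => //; first by exists P.
  by rewrite pE lte_fin in PE; nra.
have h : (1 - e) * x + e * x0 < x by nra.
have [|_ [P DP <-] PE] := @ereal_sup_gt _ (marginal_means D)
      ((1 - e) * x + e * x0)%:E.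
  by rewrite sup_fin lte_fin; lra.
have [p pE _] : exists2 p : R, _ = p%:E & _ :=
    marginal_meansP (ex_intro2 _ _ P DP erefl).
apply: (@marginal_means_interval x0 p) => //; first by exists P.
by rewrite pE lte_fin in PE; nra.
Qed.

End mean_range.

(** * Reduction of the worst-case cost to mean vectors *)

Section mean_vectors.
Context (R : realType) (m k : nat) (B : 'M[R]_(k, m)) (b : 'cV[R]_k).
Variable D : 'I_m -> arc_info R.

Definition mean_vectors : set 'cV[R]_m :=
  [set c | (forall j, (B *m c) j 0 <= b j 0) /\
           forall a, marginal_means (D a) (c a 0)%:E].

(** Linearity and a change of variables to the marginals. The weights w will be a row of [B] or the
    path vector. *)
Lemma expectation_arc_costs (Q : probability (m.-tuple R) R) (c w : 'I_m -> R) :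
  (forall a, marginal_set (D a) (distribution Q (arc_cost a))) ->
  (forall a, 'E_(distribution Q (arc_cost a))[idfun : R -> R] = (c a)%:E)%E ->
  'E_Q[fun x => (\sum_a w a * arc_cost a x)%R]%E = (\sum_a w a * c a)%:E.
Proof.
move=> QD Qc.
have iQ a : Q.-integrable setT (EFin \o arc_cost a).
  exact: (integrable_as_bounded (measurable_tnth a) (marginal_set_supp (QD a))).
have EQ a : (\int[Q]_x (arc_cost a x)%:E = (c a)%:E)%E.
  rewrite -Qc unlock.
  apply/esym/(@integral_distribution _ _ _ _ _ Q (arc_cost a) EFin _ (iQ a)).
  by apply/measurable_EFinP; exact: measurable_id.
rewrite unlock.
under eq_integral do rewrite -sumEFin.
rewrite integral_sum// => [|a]; last first.
  exact: (integrableZl measurableT (w a) (iQ a)).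
rewrite -sumEFin; apply: eq_bigr => a _.
by rewrite EFinM -EQ; exact: (integralZl measurableT (iQ a) (w a)).
Qed.

Lemma mean_ambiguityP (Q : probability (m.-tuple R) R) (c : 'cV[R]_m) :
  (forall a, marginal_set (D a) (distribution Q (arc_cost a))) ->
  (forall a, 'E_(distribution Q (arc_cost a))[idfun : R -> R] = (c a 0)%:E)%E ->
  ambiguity_set B b D Q <-> mean_vectors c.
Proof.
move=> QD Qc.
have EB j : 'E_Q[fun x => (\sum_a B j a * arc_cost a x)%R]%E =
    ((B *m c) j 0)%:E.
  by rewrite (expectation_arc_costs _ QD Qc) mxE.
split=> [[QB _]|[cB _]].
  split=> [j|a]; first by have := QB j; rewrite EB lee_fin.
  by exists (distribution Q (arc_cost a)).
by split=> // j; rewrite EB lee_fin.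
Qed.

Lemma ambiguity_set_mean (Q : probability (m.-tuple R) R) :
  ambiguity_set B b D Q -> exists2 c, mean_vectors c &
    forall a, 'E_(distribution Q (arc_cost a))[idfun : R -> R]%E = (c a 0)%:E.
Proof.
move=> QA; have QD := QA.2.
have /choice[c Qc] a : exists x : R,
    ('E_(distribution Q (arc_cost a))[idfun : R -> R] = x%:E)%E.
  have [|x xE _] := @marginal_meansP _ (D a)
      'E_(distribution Q (arc_cost a))[idfun : R -> R]%E; last by exists x.
  by exists (distribution Q (arc_cost a)).
have cE a : ('E_(distribution Q (arc_cost a))[idfun : R -> R]
    = ((\col_i c i) a 0)%:E)%E by rewrite mxE.
by exists (\col_a c a) => //; exact/(mean_ambiguityP QD cE).
Qed.

Lemma worst_case_costE (y : 'cV[R]_m) : worst_case_cost B b D y =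
  ereal_sup [set (dotv c y)%:E | c in mean_vectors].
Proof.
have E (Q : probability (m.-tuple R) R) (c : 'cV[R]_m) :
    (forall a, marginal_set (D a) (distribution Q (arc_cost a))) ->
    (forall a,
      'E_(distribution Q (arc_cost a))[idfun : R -> R] = (c a 0)%:E)%E ->
    'E_Q[fun x => (\sum_a arc_cost a x * y a 0)%R]%E = (dotv c y)%:E.
  move=> QD Qc; rewrite dotvC -(expectation_arc_costs _ QD Qc).
  by congr expectation; apply/funext => x; apply: eq_bigr => a _; rewrite mulrC.
congr ereal_sup; apply/seteqP; split=> [_ [Q QA <-]|_ [c cM <-]].
  by have [c cM Qc] := ambiguity_set_mean QA; exists c => //;
     rewrite (E Q c)//; exact: QA.2.
(* Conversely, marginals with means c_a are chosen and joined into a product measure. *)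
have /choice[P PE] a : exists P : probability R R,
    marginal_set (D a) P /\ ('E_P[idfun : R -> R] = (c a 0)%:E)%E.
  by have [P PD Pc] := cM.2 a; exists P.
have [Q QP] := tuple_probability P.
have QD a : marginal_set (D a) (distribution Q (arc_cost a)).
  move=> i; rewrite /itv_prob.
  by have := (PE a).1 i; rewrite /itv_prob -QP.
have Qc a : ('E_(distribution Q (arc_cost a))[idfun : R -> R] = (c a 0)%:E)%E.
  rewrite -(PE a).2 unlock; apply: eq_measure_integral => A mA _.
  exact: QP.
by exists Q; [exact/(mean_ambiguityP QD Qc)|exact: E].
Qed.

Let lo : 'cV[R]_m := \col_a cmin (D a).
Let hi : 'cV[R]_m := \col_a cmax (D a).

Lemma mean_vectors_box c : mean_vectors c -> box_feasible B b lo hi c.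
Proof.
move=> [Bc Mc]; split=> // a; rewrite !mxE.
exact: marginal_means_range (Mc a) _ (Mc a).
Qed.

Lemma ambiguity_mean_vectors :
  ambiguity_set B b D !=set0 -> mean_vectors !=set0.
Proof. by move=> [Q /ambiguity_set_mean[c cM _]]; exists c. Qed.

End mean_vectors.

(** * Equivalence of the robust problem and the mixed-integer program *)

Section reformulation.
Context (R : realType) (m k : nat) (Y : set 'cV[R]_m).
Context (B : 'M[R]_(k, m)) (b : 'cV[R]_k) (D : 'I_m -> arc_info R).
Hypothesis Y_ge0 : forall y, Y y -> forall a, 0 <= y a 0.
Hypothesis hwp : (forall a, mean_range_attained (D a)) \/
  ambiguity_set B b D !=set0.

Let lo : 'cV[R]_m := \col_a cmin (D a).
Let hi : 'cV[R]_m := \col_a cmax (D a).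
Local Notation feasible := (box_feasible B b lo hi).
Local Notation wc := (worst_case_cost B b D).

(** The only place where [hwp] enters. With attained extrema the intervals of means are closed, so c
    is itself a mean vector. *)
Lemma box_mean_vectors_nonempty :
  feasible !=set0 -> mean_vectors B b D !=set0.
Proof.
move=> [c [Bc hc]]; case: hwp => [att|]; last exact: ambiguity_mean_vectors.
exists c; split => // a; have [la ha] := att a.
by apply: marginal_means_interval la ha _; have := hc a; rewrite !mxE.
Qed.

(** The points (1 - e) c + e c0 are mean vectors for 0 < e <= 1, and the bound passes to c as e
    tends to 0. *)
Lemma mean_vectors_dense y v :
  (forall c, mean_vectors B b D c -> dotv c y <= v) ->
  forall c, feasible c -> dotv c y <= v.
Proof.
move=> hv c fc; have [c0 c0M] : mean_vectors B b D !=set0.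
  by apply: box_mean_vectors_nonempty; exists c.
have mix e : 0 < e -> e <= 1 -> (1 - e) * dotv c y + e * dotv c0 y <= v.
  move=> e0 e1; rewrite -!dotvZl -dotvDl; apply: hv; split=> [j|a].
    rewrite mulmxDr -!scalemxAr mxE [X in X + _]mxE [X in _ + X]mxE.
    by have := fc.1 j; have := c0M.1 j; nra.
  rewrite !mxE; apply: marginal_means_interior => //; first exact: c0M.2.
  by have := fc.2 a; rewrite !mxE.
rewrite leNgt; apply/negP => cv.
have := hv _ c0M; set x := dotv c y in cv mix *.
set z := dotv c0 y in mix * => zv.
(* As z <= v < x, this e is at most 1/2; the mixed value is then (x + v) / 2, which exceeds v. *)
have := mix ((x - v) / (2 * (x - z))).
have xz : 0 < 2 * (x - z) by lra.
rewrite ler_pdivrMr// divr_gt0//; last by lra.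
move=> /(_ isT) h; have {}h := h ltac:(lra).
have E : (x - v) / (2 * (x - z)) * (x - z) = (x - v) / 2.
  by field; rewrite gt_eqF//; lra.
by nra.
Qed.

Lemma mip_feasibleP y lam mu nu : mip_feasible Y B y lam mu nu <->
  Y y /\ box_dual B y lam mu nu.
Proof.
split=> [[l0 m0 n0 E Yy]|[Yy [l0 m0 n0 E]]].
  by split => //; split => //; rewrite -E !addrA addrN add0r.
by split => //; rewrite -addrA E addrA addNr add0r.
Qed.

Lemma worst_case_le_cost y lam mu nu : mip_feasible Y B y lam mu nu ->
  (wc y <= (mip_cost b D lam mu nu)%:E)%E.
Proof.
move=> /mip_feasibleP[_ h]; rewrite worst_case_costE.
apply: ge_ereal_sup => _ [c /mean_vectors_box cb <-]; rewrite lee_fin.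
exact: box_weak_duality cb h.
Qed.

(** This point prices each arc at its [cmax]. It keeps the worst-case cost below +oo and is the base
    point of the unbounded ray. *)
Lemma mip_feasible_trivial y : Y y -> mip_feasible Y B y 0 0 y.
Proof.
move=> Yy; split=> // [j|a|a|]; rewrite ?mxE//; first exact: Y_ge0.
by rewrite mulmx0 addr0 addNr.
Qed.

Lemma worst_case_fin_num y : feasible !=set0 -> Y y -> wc y \is a fin_num.
Proof.
move=> /box_mean_vectors_nonempty[c cM].
move=> /mip_feasible_trivial/worst_case_le_cost.
have : ((dotv c y)%:E <= wc y)%E.
  by rewrite worst_case_costE; apply: ereal_sup_ubound; exists c.
by case: (wc y).
Qed.

Lemma worst_case_attained y : feasible !=set0 -> Y y ->
  exists lam mu nu, mip_feasible Y B y lam mu nu /\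
    wc y = (mip_cost b D lam mu nu)%:E.
Proof.
move=> f0 Yy; have yfin := worst_case_fin_num f0 Yy.
have [//||lam [mu [nu [d c]]]] :=
    @box_strong_duality _ _ _ B b lo hi y (fine (wc y)).
  apply: mean_vectors_dense => c cM; rewrite -lee_fin fineK//.
  by rewrite worst_case_costE; apply: ereal_sup_ubound; exists c.
have fe : mip_feasible Y B y lam mu nu by apply/mip_feasibleP.
exists lam, mu, nu; split => //.
apply/eqP; rewrite eq_le worst_case_le_cost//=.
by rewrite -[leRHS]fineK// lee_fin.
Qed.

Lemma worst_case_infeasible y : ~ (feasible !=set0) -> wc y = -oo%E.
Proof.
move=> nf; rewrite worst_case_costE (_ : [set _ | _ in _] = set0).
  exact: ereal_sup0.
apply/seteqP; split=> // z [c /mean_vectors_box cM _].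
by case: nf; exists c.
Qed.

Lemma mip_unbounded y r : ~ (feasible !=set0) -> Y y ->
  exists lam mu nu, mip_feasible Y B y lam mu nu /\ mip_cost b D lam mu nu < r.
Proof.
move=> nf Yy; have [l [u [n [[l0 u0 n0 E] neg]]]] := box_dual_ray nf.
set C := box_dual_cost b lo hi l u n in neg.
(* Moving z times along the ray lowers the cost by |cost - r| + 1, hence below r. *)
pose z : R := (`|mip_cost b D 0 0 y - r| + 1) / - C.
have C0 : 0 < - C by lra.
have z0 : 0 <= z by apply: divr_ge0; [apply: addr_ge0|lra].
exists (z *: l), (z *: u), (y + z *: n); split.
  apply/mip_feasibleP; split => //; split=> [j|a|a|]; rewrite ?mxE.
  - exact: mulr_ge0.
  - exact: mulr_ge0.
  - by apply: addr_ge0; [exact: Y_ge0|exact: mulr_ge0].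
  by rewrite -scalemxAr addrCA -scalerDr E add0r.
have -> : mip_cost b D (z *: l) (z *: u) (y + z *: n) =
    mip_cost b D 0 0 y + z * C.
  have d0 p (w : 'cV[R]_p) : dotv w 0 = 0 by rewrite dotvE mulmx0 mxE.
  by rewrite /C /box_dual_cost /mip_cost !dotvZr dotvDr dotvZr !d0; ring.
have -> : z * C = - (`|mip_cost b D 0 0 y - r| + 1).
  by rewrite -[C]opprK mulrN divfK// gt_eqF.
by have := ler_norm (mip_cost b D 0 0 y - r); lra.
Qed.

Lemma dro_mip_value : dro_value Y B b D = mip_value Y B b D.
Proof.
apply/eqP; rewrite eq_le; apply/andP; split.
  apply: le_ereal_inf_tmp => _ [y [lam [mu [nu [fe ->]]]]].
  apply: le_trans (worst_case_le_cost fe).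
  by apply: ereal_inf_lbound; exists y => //; case: fe.
apply: le_ereal_inf_tmp => _ [y Yy <-].
have [f0|nf] := pselect (feasible !=set0).
  have [lam [mu [nu [fe ->]]]] := worst_case_attained f0 Yy.
  by apply: ereal_inf_lbound; exists y, lam, mu, nu.
rewrite worst_case_infeasible//.
have mip_le r : (mip_value Y B b D <= r%:E)%E.
  have [lam [mu [nu [fe /ltW cr]]]] := mip_unbounded r nf Yy.
  apply: le_trans (_ : ((mip_cost b D lam mu nu)%:E <= _)%E);
    last by rewrite lee_fin.
  by apply: ereal_inf_lbound; exists y, lam, mu, nu.
(* A finite value x would satisfy x <= x - 1, and +oo would be at most 0; only -oo remains. *)
case: (mip_value Y B b D) mip_le => [x /(_ (x - 1))|/(_ 0)|//] //.
by rewrite lee_fin => h; exfalso; move: h; lra.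
Qed.

(** If the polytope is empty, neither side has an optimum: the worst-case cost is not finite and the
    program is unbounded. Otherwise weak duality and attainment transfer optimality both ways. *)
Lemma dro_mip_optimal y : dro_optimal Y B b D y <->
  exists lam mu nu, mip_optimal Y B b D y lam mu nu.
Proof.
split=> [[Yy yfin yopt]|[lam [mu [nu [fe opt]]]]].
  have f0 : feasible !=set0.
    by apply: contrapT => /(worst_case_infeasible y) wcy; rewrite wcy in yfin.
  have [lam [mu [nu [fe wcy]]]] := worst_case_attained f0 Yy.
  exists lam, mu, nu; split => // y' lam' mu' nu' fe'.
  rewrite -lee_fin -wcy; apply: le_trans (worst_case_le_cost fe').
  by apply: yopt; case: fe'.
have Yy : Y y by case: fe.
have f0 : feasible !=set0.
  apply: contrapT => nf.
  have [l [u [n [/opt]]]] := mip_unbounded (mip_cost b D lam mu nu) nf Yy.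
  by rewrite leNgt => /negP.
split => // [|y' Yy']; first exact: worst_case_fin_num.
have [l [u [n [fe' ->]]]] := worst_case_attained f0 Yy'.
by apply: le_trans (worst_case_le_cost fe) _; rewrite lee_fin; exact: opt fe'.
Qed.

End reformulation.

Theorem theorem3 (R : realType) (n m k : nat)
  (src tgt : 'I_m -> 'I_n) (s t : 'I_n)
  (hconn : graph_connected src tgt) (hst : s != t)
  (B : 'M[R]_(k, m)) (b : 'cV[R]_k) (D : 'I_m -> arc_info R)
  (hA1 : forall a, marginal_slater (D a))
  (hA2 : forall a, endpoints_distinct (D a))
  (hwp : (forall a, mean_range_attained (D a)) \/
         ambiguity_set B b D !=set0) :
  let Y : set 'cV[R]_m := path_vectors src tgt s t in
  dro_value Y B b D = mip_value Y B b D /\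
  (forall y : 'cV[R]_m,
     dro_optimal Y B b D y <->
     exists lam mu nu, mip_optimal Y B b D y lam mu nu).
Proof.
move=> Y.
have Y_ge0 y : Y y -> forall a, 0 <= y a 0.
  by move=> [y01 _] a; case: (y01 a) => ->.
by split; [exact: dro_mip_value|move=> y; exact: dro_mip_optimal].
Qed.
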